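(* The stationary probability distribution $\pi^{\mathrm i}$ of the stoned inhomogeneous TASEP $\blacktriangle\mathrm{iTASEP}_\lambda$ is given by \[\pi^{\mathrm i}(\mu,\sigma)=\frac1{|\Omega|}\lim_{R\to\infty}\frac{\Psi_\mu(\sigma\boldsymbol\chi)}{\Pi_\lambda(\boldsymbol\chi)}\qquad((\mu,\sigma)\in S_\lambda\times\Omega).\]
   Context: Fix parameters $a_k\in(0,1)$ for each integer $k\ge0$, and a nondecreasing tuple $\lambda=(\lambda_1\le\cdots\le\lambda_n)$ of nonnegative integers with set of rearrangements $S_\lambda$. For $w\in\mathfrak S_n$ and a tuple $y$, $wy=(y_{w^{-1}(1)},\dots,y_{w^{-1}(n)})$; for a polynomial $f$, $(wf)(\mathbf x)=f(w\mathbf x)$. Indices are modulo $n$; $\overline s_i$ ($i\in\mathbb Z/n\mathbb Z$) is the transposition of $i$ and $i+1$; $c$ is the cycle $(1\,2\cdots n)$. Inhomogeneous TASEP polynomials (Cantini) $(\Psi_\mu(\mathbf x))_{\mu\in S_\lambda}$ are polynomials in $x_1,\dots,x_n$ with coefficients rational in $a_{\lambda_1},\dots,a_{\lambda_n}$, determined up to a common scalar factor (a normalization is fixed) by: $\frac{x_i(x_{i+1}-a_{\mu_{i+1}})}{a_{\mu_{i+1}}(x_i-x_{i+1})}(1-\overline s_i)\Psi_\mu=\Psi_{\overline s_i\mu}$ if $\mu_i<\mu_{i+1}$; $\overline s_i\Psi_\mu=\Psi_\mu$ if $\mu_i=\mu_{i+1}$; $c\Psi_{c\mu}=\Psi_\mu$.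 $\Pi_\lambda=\sum_{\mu\in S_\lambda}\Psi_\mu$ (a symmetric polynomial). Stones $\blacktriangle_1,\dots,\blacktriangle_n$ with densities $\varrho$ taking exactly the two values $1,2$, $1=\varrho(\blacktriangle_1)\le\cdots\le\varrho(\blacktriangle_n)=2$. $\Omega$: the $\sigma\in\mathfrak S_n$ such that for each density the stones of that density appear in the same cyclic order in $\blacktriangle_{\sigma^{-1}(1)},\dots,\blacktriangle_{\sigma^{-1}(n)}$ as in $\blacktriangle_1,\dots,\blacktriangle_n$ (stone $\blacktriangle_j$ sits on site $\sigma(j)$ of a ring $\mathbb Z/n\mathbb Z$). $\mathfrak K(\sigma)=\#\{i:\varrho(\blacktriangle_{\sigma^{-1}(i)})<\varrho(\blacktriangle_{\sigma^{-1}(i+1)})\}$. For each $j$ with $\varrho(\blacktriangle_j)=1$ fix $p(j)\in[0,1)$, with $p(j)>0$ for at least one such $j$. For real $R>1$ let $\boldsymbol\chi=(\chi_1,\dots,\chi_n)$ with $\chi_j=1/p(j)$ if $\varrho(\blacktriangle_j)=1$ and $p(j)>0$, and $\chi_j=R$ otherwise. $\blacktriangle\mathrm{iTASEP}_\lambda$ is the Markov chain on $S_\lambda\times\Omega$: if $\varrho(\blacktriangle_{\sigma^{-1}(i)})<\varrho(\blacktriangle_{\sigma^{-1}(i+1)})$ and $\mu_i>\mu_{i+1}$, then $\mathbb P((\mu,\sigma)\to(\overline s_i\mu,\overline s_i\sigma))=\frac1np(\sigma^{-1}(i))a_{\mu_i}$ and $\mathbb P((\mu,\sigma)\to(\mu,\overline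 s_i\sigma))=\frac1n[1-p(\sigma^{-1}(i))a_{\mu_i}]$; if the density condition holds and $\mu_i\le\mu_{i+1}$, $\mathbb P((\mu,\sigma)\to(\mu,\overline s_i\sigma))=\frac1n$; $\mathbb P((\mu,\sigma)\to(\mu,\sigma))=1-\mathfrak K(\sigma)/n$; all other probabilities $0$. This chain is irreducible. (Its stone marginal, the auxiliary TASEP, is uniform on $\Omega$.) *)

(* Defs.v *)
From HB Require Import structures.
From mathcomp Require Import all_boot all_order all_algebra all_fingroup.
From mathcomp Require Import all_classical all_reals all_analysis.
From mathcomp Require mpoly.
Set Implicit Arguments. Unset Strict Implicit. Unset Printing Implicit Defensive.
Import Order.TTheory GRing.Theory Num.Theory.
Local Open Scope ring_scope.

(* Sites 1..n and stones 1..n are both encoded by 'I_n (0-based).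
   Indices are taken modulo n: the successor of site i is ordS i. *)

Section Stoned.
Variable n : nat.

Definition act_tuple (T : Type) (w : 'S_n) (y : 'I_n -> T) : 'I_n -> T :=
  fun j => y (w^-1%g j).

Definition act_word (w : 'S_n) (mu : seq nat) : seq nat :=
  [seq nth 0%N mu (w^-1%g j) | j <- enum 'I_n].

Definition sbar (i : 'I_n) : 'S_n := tperm i (ordS i).

Definition cyc : 'S_n := perm (@ordS_inj n).

Variable R : realType.

Notation poly := (mpoly.mpoly n R).
Definition ev (x : 'I_n -> R) (f : poly) : R := mpoly.meval x f.

(* The defining relations of the inhomogeneous TASEP polynomials
   (Psi_mu)_{mu in S_lambda}, written as polynomial identities (i.e. for
   every real point x); the exchange relation is multiplied through by
   a_{mu_{i+1}} (x_i - x_{i+1}). *)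
Definition is_iTASEP_family (a : nat -> R) (lam : seq nat)
    (Psi : seq nat -> poly) : Prop :=
  forall mu, mu \in permutations lam ->
  [/\ forall (i : 'I_n) (x : 'I_n -> R),
        (nth 0%N mu i < nth 0%N mu (ordS i))%N ->
        x i * (x (ordS i) - a (nth 0%N mu (ordS i)))
          * (ev x (Psi mu) - ev (act_tuple (sbar i) x) (Psi mu))
        = a (nth 0%N mu (ordS i)) * (x i - x (ordS i))
          * ev x (Psi (act_word (sbar i) mu)),
      forall (i : 'I_n) (x : 'I_n -> R),
        nth 0%N mu i = nth 0%N mu (ordS i) ->
        ev (act_tuple (sbar i) x) (Psi mu) = ev x (Psi mu)
    & forall x : 'I_n -> R,
        ev (act_tuple cyc x) (Psi (act_word cyc mu)) = ev x (Psi mu)].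

Definition Pi_ev (lam : seq nat) (Psi : seq nat -> poly) (x : 'I_n -> R) : R :=
  \sum_(mu <- permutations lam) ev x (Psi mu).

Variable rho : 'I_n -> nat.   (* densities of the stones *)

Definition cyc_eq (s t : seq nat) : bool :=
  has (fun k => s == rot k t) (iota 0 (size t).+1).

(* stones of density d, listed along the sites 1..n for configuration sigma *)
Definition stones_along (d : nat) (sigma : 'S_n) : seq nat :=
  [seq nat_of_ord (sigma^-1%g i) | i <- enum 'I_n & rho (sigma^-1%g i) == d].
Definition stones_of (d : nat) : seq nat :=
  [seq nat_of_ord j | j <- enum 'I_n & rho j == d].

(* Omega (densities take only the values 1 and 2) *)
Definition Omega : {set 'S_n} :=
  [set sigma | cyc_eq (stones_along 1 sigma) (stones_of 1)
            && cyc_eq (stones_along 2 sigma) (stones_of 2)].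

Definition up (sigma : 'S_n) (i : 'I_n) : bool :=
  (rho (sigma^-1%g i) < rho (sigma^-1%g (ordS i)))%N.

Definition Kfrak (sigma : 'S_n) : nat := #|[set i | up sigma i]|.

Variables (a : nat -> R) (p : 'I_n -> R).

(* Transition probability of the stoned inhomogeneous TASEP.
   \bar s_i sigma is the composite \bar s_i o sigma, i.e. (sigma * sbar i)%g. *)
Definition trans (mu : seq nat) (sigma : 'S_n) (mu' : seq nat) (sigma' : 'S_n) : R :=
  (if (mu' == mu) && (sigma' == sigma) then 1 - (Kfrak sigma)%:R / n%:R else 0)
  + \sum_(i : 'I_n | up sigma i)
      (if (nth 0%N mu (ordS i) < nth 0%N mu i)%N then
         (if (mu' == act_word (sbar i) mu) && (sigma' == (sigma * sbar i)%g)
          then n%:R^-1 * (p (sigma^-1%g i) * a (nth 0%N mu i)) else 0)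
         + (if (mu' == mu) && (sigma' == (sigma * sbar i)%g)
          then n%:R^-1 * (1 - p (sigma^-1%g i) * a (nth 0%N mu i)) else 0)
       else
         (if (mu' == mu) && (sigma' == (sigma * sbar i)%g) then n%:R^-1 else 0)).

Definition is_stationary_distribution (lam : seq nat)
    (pi : seq nat -> 'S_n -> R) : Prop :=
  [/\ forall mu sigma, mu \in permutations lam -> sigma \in Omega ->
        0 <= pi mu sigma,
      \sum_(mu <- permutations lam) \sum_(sigma in Omega) pi mu sigma = 1
    & forall mu' sigma', mu' \in permutations lam -> sigma' \in Omega ->
        pi mu' sigma' =
        \sum_(mu <- permutations lam) \sum_(sigma in Omega)
           pi mu sigma * trans mu sigma mu' sigma'].

(* the vector chi depending on the real parameter r (= R in the paper) *)
Definition chi (r : R) : 'I_n -> R :=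
  fun j => if (rho j == 1%N) && (0 < p j) then (p j)^-1 else r.

End Stoned.

(* Main.v *)
Require Import Defs.
From HB Require Import structures.
From mathcomp Require Import all_boot all_order all_algebra all_fingroup.
From mathcomp Require Import all_classical all_reals all_analysis.
From mathcomp Require mpoly.
From mathcomp Require Import ring lra zify.
Set Implicit Arguments. Unset Strict Implicit. Unset Printing Implicit Defensive.
Import Order.TTheory GRing.Theory Num.Theory numFieldNormedType.Exports.
Local Open Scope classical_set_scope.
Local Open Scope ring_scope.

(** Write [F_mu(x)] for [Psi_mu] at [x]. If all [x_j >= 1], the defining relations say that
    [F(s_i x)] is the image of [F(x)] under the operator that swaps a descent of [mu] at sites
    i, i+1 with larger particle k with probability
    [a_k (x_{i+1} - x_i) / (x_i (x_{i+1} - a_k))]. This operator preserves total mass, so [Pi] is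
    symmetric; along the auxiliary TASEP, where [x_i = 1/p] and [x_{i+1} = R], the probability
    tends to [p a_k], which is exactly the move of the stoned chain. Stationarity of the limit
    follows because a ring has as many density ascents as descents.

    The limit exists, and is nonnegative, because all [F_mu(x)] have the same sign: carrying a
    maximal entry of [x] around the ring is a closed loop of stochastic moves, under which the
    positive part of [F] can only lose mass, hence no cancellation occurs on the way. The words
    on which [F] is positive are then closed under rotation and under sorting of descents, so
    they include [lam] if there are any; the same holds for the negative part. Therefore
    [|F_mu| <= |Pi|], and a bounded ratio of polynomials in R converges. *)

(** * Permutations acting on tuples and on words *)

Section Actions.
Variable n : nat.

Lemma act_tupleM (T : Type) (v w : 'S_n) (x : 'I_n -> T) :
  act_tuple w (act_tuple v x) = act_tuple (v * w)%g x.
Proof. by apply/funext => j; rewrite /act_tuple invMg permM. Qed.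

Lemma act_tuple1 (T : Type) (x : 'I_n -> T) : act_tuple 1%g x = x.
Proof. by apply/funext => j; rewrite /act_tuple invg1 perm1. Qed.

Lemma nth_act_word (w : 'S_n) (mu : seq nat) (j : 'I_n) :
  nth 0%N (act_word w mu) j = nth 0%N mu (w^-1%g j).
Proof. by rewrite (nth_map j) ?size_enum_ord // nth_ord_enum. Qed.

Lemma size_act_word (w : 'S_n) (mu : seq nat) : size (act_word w mu) = n.
Proof. by rewrite size_map size_enum_ord. Qed.

Lemma act_wordM (v w : 'S_n) (mu : seq nat) :
  act_word w (act_word v mu) = act_word (v * w)%g mu.
Proof. by apply: eq_map => j; rewrite nth_act_word invMg permM. Qed.

Lemma act_word1 (mu : seq nat) : size mu = n -> act_word (1%g : 'S_n) mu = mu.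
Proof.
move=> sz; apply: (@eq_from_nth _ 0%N) => [|j]; rewrite size_act_word //.
by move=> jn; rewrite (nth_act_word _ _ (Ordinal jn)) invg1 perm1.
Qed.

Lemma perm_act_word (w : 'S_n) (mu : seq nat) :
  size mu = n -> perm_eq (act_word w mu) mu.
Proof.
move=> sz; rewrite -[X in perm_eq _ X](act_word1 sz) /act_word.
have -> : [seq nth 0%N mu (w^-1%g j) | j <- enum 'I_n] =
    map (fun j : 'I_n => nth 0%N mu j) (map (w^-1)%g (enum 'I_n)).
  by rewrite -[RHS]map_comp; apply: eq_map.
under [X in perm_eq _ X]eq_map do rewrite invg1 perm1.
apply: perm_map; apply: uniq_perm => [||j].
- by rewrite (map_inj_uniq (@perm_inj _ _)) enum_uniq.
- exact: enum_uniq.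
- by rewrite mem_enum; apply/mapP; exists (w j); rewrite ?mem_enum ?permK.
Qed.

Lemma act_tuple_sbarK (T : Type) (i : 'I_n) (x : 'I_n -> T) :
  act_tuple (sbar i) (act_tuple (sbar i) x) = x.
Proof. by rewrite act_tupleM tperm2 act_tuple1. Qed.

Lemma act_sbarL (T : Type) (i : 'I_n) (x : 'I_n -> T) :
  act_tuple (sbar i) x i = x (ordS i).
Proof. by rewrite /act_tuple tpermV tpermL. Qed.

Lemma act_sbarR (T : Type) (i : 'I_n) (x : 'I_n -> T) :
  act_tuple (sbar i) x (ordS i) = x i.
Proof. by rewrite /act_tuple tpermV tpermR. Qed.

Lemma nth_sbarL (i : 'I_n) (mu : seq nat) :
  nth 0%N (act_word (sbar i) mu) i = nth 0%N mu (ordS i).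
Proof. by rewrite nth_act_word tpermV tpermL. Qed.

Lemma nth_sbarR (i : 'I_n) (mu : seq nat) :
  nth 0%N (act_word (sbar i) mu) (ordS i) = nth 0%N mu i.
Proof. by rewrite nth_act_word tpermV tpermR. Qed.

Lemma act_tuple_sbar_id (T : Type) (i : 'I_n) (x : 'I_n -> T) :
  x i = x (ordS i) -> act_tuple (sbar i) x = x.
Proof.
by move=> e; apply/funext => j; rewrite /act_tuple tpermV; case: tpermP => [->|->|].
Qed.

Lemma expg_cyc (k : nat) (j : 'I_n) : ((cyc n ^+ k)%g j = (j + k) %% n :> nat)%N.
Proof.
elim: k => [|k IH]; first by rewrite expg0 perm1 addn0 modn_small.
by rewrite expgSr permM permE /= IH -addn1 modnDml addn1 addnS.
Qed.

Lemma expg_cyc_n : (cyc n ^+ n = 1)%g.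
Proof.
by apply/permP => j; apply/ord_inj; rewrite perm1 expg_cyc modnDr modn_small.
Qed.

(** It extends the symmetry of [Pi] from the [sbar i] to all permutations. For n <= 1 the group is
    trivial; otherwise the step 1 is coprime to n. *)
Lemma gen_sbar : <<[set sbar i | i : 'I_n]%SET>>%g = [set: 'S_n]%SET.
Proof.
case: n => [|[|m]].
- by apply/setP => w; rewrite inE (_ : w = 1%g) ?group1 //; apply/permP => -[].
- apply/setP => w; rewrite inE (_ : w = 1%g) ?group1 //.
  by apply/permP => j; rewrite !ord1.
- rewrite -(@gen_tperm_step _ (inord 1)); last by rewrite inordK // coprimen1.
  congr generated; apply: eq_imset => i; congr tperm.
  by apply/ord_inj; rewrite /= inordK // addn1.
Qed.

End Actions.

(** * Rearrangements of [lam]: reindexing sums and sorting *)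

Section Words.
Variables (n : nat) (lam : seq nat).
Hypothesis size_lam : size lam = n.

Lemma size_rearr mu : mu \in permutations lam -> size mu = n.
Proof. by rewrite mem_permutations => /perm_size ->. Qed.

Lemma mem_act_word (w : 'S_n) mu :
  mu \in permutations lam -> act_word w mu \in permutations lam.
Proof.
move=> h; have sz := size_rearr h; move: h.
by rewrite !mem_permutations; apply: perm_trans; apply: perm_act_word.
Qed.

Lemma act_wordK (v w : 'S_n) mu : (v * w = 1)%g ->
  mu \in permutations lam -> act_word w (act_word v mu) = mu.
Proof. by move=> e h; rewrite act_wordM e act_word1 ?size_rearr. Qed.

Lemma act_word_sbarK (i : 'I_n) mu :
  mu \in permutations lam -> act_word (sbar i) (act_word (sbar i) mu) = mu.
Proof. by apply: act_wordK; rewrite tperm2. Qed.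

Lemma act_word_eqC (i : 'I_n) mu nu :
  mu \in permutations lam -> nu \in permutations lam ->
  (nu == act_word (sbar i) mu) = (mu == act_word (sbar i) nu).
Proof. by move=> hm hn; apply/eqP/eqP => ->; rewrite act_word_sbarK. Qed.

Lemma reindex_words (R : nmodType) (w : 'S_n) (g : seq nat -> R) :
  \sum_(mu <- permutations lam) g (act_word w mu) =
  \sum_(mu <- permutations lam) g mu.
Proof.
rewrite -(big_map (act_word w) xpredT g); apply: perm_big.
have inj : {in permutations lam &, injective (act_word w)}.
  move=> mu nu hm hn /(congr1 (act_word w^-1%g)).
  by rewrite !act_wordK ?mulgV.
apply: uniq_perm; rewrite ?permutations_uniq // ?map_inj_in_uniq ?permutations_uniq //.
move=> mu; apply/mapP/idP => [[nu hn ->]|h]; first exact: mem_act_word.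
exists (act_word w^-1%g mu); first exact: mem_act_word.
by rewrite act_wordK ?mulVg.
Qed.

Lemma sum_words_eq (R : nmodType) nu (g : seq nat -> R) :
  nu \in permutations lam ->
  \sum_(mu <- permutations lam) (if nu == mu then g mu else 0) = g nu.
Proof.
move=> h; rewrite (bigD1_seq nu) ?permutations_uniq //= eqxx.
rewrite big1_seq ?addr0 // => mu /andP[/negPf ne _].
by rewrite eq_sym ne.
Qed.

(* The swaps considered never involve the pair of last and first sites, so
   sum_j j * mu_j increases until the word is sorted. *)
Lemma sort_descents (Q : seq nat -> Prop) :
  sorted leq lam ->
  (forall mu (i : 'I_n), mu \in permutations lam -> Q mu -> (i.+1 < n)%N ->
     (nth 0%N mu (ordS i) < nth 0%N mu i)%N -> Q (act_word (sbar i) mu)) ->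
  forall mu, mu \in permutations lam -> Q mu -> Q lam.
Proof.
move=> slam step.
pose W mu := (\sum_(j < n) j * nth 0%N mu j)%N.
(* A crude upper bound of [W], so that B - W serves as the decreasing measure. *)
pose B := (\sum_(mu <- permutations lam) W mu)%N.
have WB mu : mu \in permutations lam -> (W mu <= B)%N.
  by move=> h; rewrite /B (bigD1_seq mu) ?permutations_uniq //= leq_addr.
move=> mu; have [k] := ubnP (B - W mu)%N.
elim: k mu => // k IH mu hB hm Qm.
have [smu|/(sortedP 0%N) nsmu] := boolP (sorted leq mu).
  by rewrite -(sorted_eq leq_trans anti_leq smu slam) // -mem_permutations.
have [j [jn jd]] : exists j,
    (j.+1 < n)%N /\ (nth 0%N mu j.+1 < nth 0%N mu j)%N.
  apply: contrapT => H; apply: nsmu => i; rewrite (size_rearr hm) => hi.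
  by rewrite leqNgt; apply/negP => hd; apply: H; exists i.
pose i : 'I_n := Ordinal (ltnW jn).
have vS : ordS i = j.+1 :> nat by rewrite /= modn_small.
have Wlt : (W mu < W (act_word (sbar i) mu))%N.
  have ne : ordS i != i.
    by apply/eqP => /(congr1 (@nat_of_ord n)); rewrite vS /=; lia.
  have E (f : 'I_n -> nat) : (\sum_(l < n) l * f l = j * f i + j.+1 * f (ordS i)
      + \sum_(l < n | (l != i) && (l != ordS i)) l * f l)%N.
    by rewrite -vS (bigD1 i) // (bigD1 (ordS i)) // -addnA.
  rewrite /W !E nth_sbarL nth_sbarR.
  rewrite (eq_bigr (fun l : 'I_n => l * nth 0%N (act_word (sbar i) mu) l)%N).
    by rewrite vS ltn_add2r /=; move: jd; nia.
  by move=> l /andP[h1 h2]; rewrite nth_act_word tpermV tpermD // eq_sym.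
have hm' := mem_act_word (sbar i) hm; have hB' := WB _ hm'.
apply: (IH (act_word (sbar i) mu)) => //; first by lia.
by apply: step => //; rewrite vS.
Qed.

End Words.

(** * The exchange relation as a mass-preserving operator, and the symmetry of [Pi] *)

Section Exchange.
Variables (n : nat) (R : realType).

(* The probability of swapping sites i, i+1 when a descent with larger
   particle k is swapped with probability [q k]. *)
Definition hop (i : 'I_n) (q : nat -> R) (mu : seq nat) : R :=
  if (nth 0%N mu (ordS i) < nth 0%N mu i)%N then q (nth 0%N mu i) else 0.

Definition push (i : 'I_n) (q : nat -> R) (v : seq nat -> R) (nu : seq nat) : R :=
  (1 - hop i q nu) * v nu
  + hop i q (act_word (sbar i) nu) * v (act_word (sbar i) nu).

Lemma hop_sbar i q mu : hop i q (act_word (sbar i) mu) =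
  if (nth 0%N mu i < nth 0%N mu (ordS i))%N then q (nth 0%N mu (ordS i)) else 0.
Proof. by rewrite /hop nth_sbarL nth_sbarR. Qed.

Variables (a : nat -> R) (lam : seq nat) (Psi : seq nat -> mpoly.mpoly n R).
Hypothesis size_lam : size lam = n.
Hypothesis a01 : forall k, 0 < a k < 1.
Hypothesis famP : is_iTASEP_family a lam Psi.

Lemma sum_push i q v : \sum_(nu <- permutations lam) push i q v nu =
  \sum_(nu <- permutations lam) v nu.
Proof.
rewrite big_split /= (reindex_words size_lam _ (fun nu => hop i q nu * v nu)).
by rewrite -big_split; apply: eq_bigr => nu _ /=; ring.
Qed.

(** This is what solving the exchange relation for the values at s_i x gives. With entries at least
    1 it is negative when x_{i+1} < x_i; [exchange] and [sum_push] are identities that hold for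
    either sign. *)
Definition rate (i : 'I_n) (x : 'I_n -> R) (k : nat) : R :=
  a k * (x (ordS i) - x i) / (x i * (x (ordS i) - a k)).

Lemma exchange (i : 'I_n) (x : 'I_n -> R) nu : (forall j, 1 <= x j) ->
  nu \in permutations lam ->
  ev (act_tuple (sbar i) x) (Psi nu) =
  push i (rate i x) (fun mu => ev x (Psi mu)) nu.
Proof.
move=> x1 hn; rewrite /push hop_sbar /hop /rate.
have hx := x1 i; have hy := x1 (ordS i).
case: ltngtP => h.
- have := x1 i; have := x1 (ordS i).
  move: h; set b := act_word (sbar i) nu; set k := nth _ nu i => h _ _.
  have [/(_ i) H _ _] := famP (mem_act_word size_lam (sbar i) hn).
  move: H; rewrite nth_sbarL nth_sbarR -/k -/b => H.
  (* Here [nu] has a descent at i, so the relation is that of [b], used at x and at s_i x: the first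
     gives the difference [D] in terms of [F'], the second gives [G] in terms of [D]. *)
  have H1 := H x h; have := H (act_tuple (sbar i) x) h.
  rewrite act_sbarL act_sbarR act_tuple_sbarK (act_word_sbarK size_lam i hn) in H1 *.
  have /andP[a0 a1] := a01 k.
  (* The second relation cannot be divided by x_i - x_{i+1} when the two entries agree; then s_i x =
     x and the rate is 0. *)
  have [e _|ne H2] := eqVneq (x i) (x (ordS i)).
    by rewrite act_tuple_sbar_id // e subrr mulr0 mul0r; ring.
  have ne' : x i - x (ordS i) != 0 by rewrite subr_eq0.
  have ne1 : x i != 0 by lra.
  have ne2 : x (ordS i) - a k != 0 by rewrite subr_eq0; lra.
  have ak : a k != 0 by lra.
  move: H1 H2; set F := ev x (Psi b); set F' := ev x (Psi nu).
  set G := ev _ (Psi nu); set D := F - _ => H1 H2.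
  have ED : D = a k * (x i - x (ordS i)) * F' / (x i * (x (ordS i) - a k)).
    by rewrite -H1; field; rewrite ne1 ne2.
  have EG : G = x (ordS i) * (x i - a k) * D / (a k * (x i - x (ordS i))).
    have -> : x (ordS i) * (x i - a k) * D =
       a k * (x i - x (ordS i)) * G by rewrite /D; lra.
    by field; rewrite ak ne'.
  by rewrite EG ED; field; rewrite ne1 ne2 ak ne'.
- have [/(_ i x h) H _ _] := famP hn.
  have /andP[a0 a1] := a01 (nth 0%N nu (ordS i)).
  have ne1 : x i != 0 by lra.
  have ne2 : x (ordS i) - a (nth 0%N nu (ordS i)) != 0 by rewrite subr_eq0; lra.
  rewrite subr0 mul1r.
  move: H; set G := ev (act_tuple _ _) _; set F := ev x (Psi nu); set F' := ev x _ => H.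
  have -> : G = F - x i * (x (ordS i) - a (nth 0%N nu (ordS i))) * (F - G)
      / (x i * (x (ordS i) - a (nth 0%N nu (ordS i)))).
    by field; rewrite ne1 ne2.
  by rewrite H; field; rewrite ne1 ne2.
- have [_ /(_ i x (esym h)) H _] := famP hn.
  by rewrite H; ring.
Qed.

Lemma Pi_ev_sbar (i : 'I_n) (x : 'I_n -> R) : (forall j, 1 <= x j) ->
  Pi_ev lam Psi (act_tuple (sbar i) x) = Pi_ev lam Psi x.
Proof.
move=> x1; rewrite /Pi_ev -(sum_push i (rate i x) (fun mu => ev x (Psi mu))).
by apply: eq_big_seq => nu hn; rewrite exchange.
Qed.

Lemma Pi_ev_perm (w : 'S_n) (x : 'I_n -> R) : (forall j, 1 <= x j) ->
  Pi_ev lam Psi (act_tuple w x) = Pi_ev lam Psi x.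
Proof.
move=> x1.
(* Quantifying over all points with entries at least 1, a condition stable under permuting them,
   makes this set closed under products. *)
pose G := [set w : 'S_n | `[< forall x : 'I_n -> R, (forall j, 1 <= x j) ->
  Pi_ev lam Psi (act_tuple w x) = Pi_ev lam Psi x >]]%SET.
have gG : group_set G.
  apply/group_setP; split.
    by rewrite inE; apply/asboolP => y _; rewrite act_tuple1.
  move=> u v; rewrite !inE => /asboolP Hu /asboolP Hv; apply/asboolP => y y1.
  by rewrite -act_tupleM Hv ?Hu // => j; apply: y1.
suff : w \in Group gG by rewrite inE => /asboolP; apply.
have sub : <<[set sbar i | i : 'I_n]%SET>>%g \subset Group gG.
  rewrite gen_subG; apply/fintype.subsetP => _ /imsetP[i _ ->].
  by rewrite inE; apply/asboolP => y y1; apply: Pi_ev_sbar.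
by apply: (fintype.subsetP sub); rewrite gen_sbar inE.
Qed.

End Exchange.

(** * All values at a point with a maximal, not constant, entry have one sign *)

Section Positivity.
Variables (k : nat) (R : realType).
Local Notation n := k.+2.

Definition pen : 'I_n := inord k.

Lemma ordS_pen : ordS pen = ord_max.
Proof. by apply/ord_inj; rewrite /= inordK // modn_small. Qed.

(* Moving the stone on the last site one step to the left, and then rotating
   the ring, brings it back to the last site. *)
Definition uturn : 'S_n := (sbar pen * cyc n)%g.

Lemma uturn_max : uturn ord_max = ord_max.
Proof. by rewrite permM /sbar ordS_pen tpermR permE ordS_pen. Qed.

Lemma uturnE (j : 'I_n) : (j < k.+1)%N -> (uturn j = j.+1 %% k.+1 :> nat)%N.
Proof.
move=> jk; rewrite permM permE /sbar ordS_pen.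
have [e|ne] := eqVneq j pen.
  by rewrite e tpermL /= modnn inordK // modnn.
have jk' : (j < k)%N.
  rewrite ltn_neqAle -ltnS jk andbT; apply: contraNneq ne => e.
  by apply/eqP/ord_inj; rewrite inordK.
rewrite tpermD ?(eq_sym pen) //=; first by rewrite !modn_small // !ltnS // ltnW.
by rewrite -val_eqE /= neq_ltn jk orbT.
Qed.

Lemma expg_uturn t (j : 'I_n) : (j < k.+1)%N ->
  ((uturn ^+ t)%g j = (j + t) %% k.+1 :> nat)%N.
Proof.
move=> jk; elim: t => [|t IH]; first by rewrite expg0 perm1 addn0 modn_small.
by rewrite expgSr permM uturnE IH ?ltn_mod // -addn1 modnDml addn1 addnS.
Qed.

Lemma expg_uturn_max t : (uturn ^+ t)%g ord_max = ord_max.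
Proof.
elim: t => [|t IH]; first by rewrite expg0 perm1.
by rewrite expgSr permM IH uturn_max.
Qed.

(** [uturn] fixes the last site and permutes the other k+1 cyclically, so the trip of the maximal
    entry around the ring closes up after k+1 steps. *)
Lemma expg_uturn_loop : (uturn ^+ k.+1 = 1)%g.
Proof.
apply/permP => j; rewrite perm1; have [jk|jk] := ltnP j k.+1.
  by apply/ord_inj; rewrite expg_uturn // modnDr modn_small.
have -> : j = ord_max by apply/ord_inj/eqP; rewrite eqn_leq jk -ltnS ltn_ord.
exact: expg_uturn_max.
Qed.

Variables (a : nat -> R) (lam : seq nat) (Psi : seq nat -> mpoly.mpoly n R).
Hypothesis size_lam : size lam = n.
Hypothesis sorted_lam : sorted leq lam.
Hypothesis a01 : forall l, 0 < a l < 1.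
Hypothesis famP : is_iTASEP_family a lam Psi.

Let S := permutations lam.
Let F (x : 'I_n -> R) mu := ev x (Psi mu).
Let step (x : 'I_n -> R) : 'I_n -> R := act_tuple uturn x.

Lemma ev_expg_cyc t x mu : mu \in S ->
  ev (act_tuple (cyc n ^+ t)%g x) (Psi (act_word (cyc n ^+ t)%g mu)) =
  ev x (Psi mu).
Proof.
move=> hm; elim: t => [|t IH].
  by rewrite expg0 act_tuple1 act_word1 // (size_rearr size_lam hm).
have hm' := mem_act_word size_lam (cyc n ^+ t)%g hm.
have [_ _ H] := famP hm'.
by rewrite expgSr -act_tupleM -act_wordM H IH.
Qed.

(** With the largest entry on the last site, every swap made by [step] has a rate in [0, 1), so
    [push] is stochastic. *)
Definition dominated (x : 'I_n -> R) :=
  forall j, 1 <= x j /\ x j <= x ord_max.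

Lemma step_max x : step x ord_max = x ord_max.
Proof. by rewrite /step /act_tuple -{1}uturn_max permK. Qed.

Lemma dominated_step x : dominated x -> dominated (step x).
Proof. by move=> H j; rewrite step_max; apply: H. Qed.

Lemma iter_step t x : iter t step x = act_tuple (uturn ^+ t)%g x.
Proof.
elim: t => [|t IH]; first by rewrite expg0 act_tuple1.
by rewrite iterS IH /step act_tupleM expgSr.
Qed.

Lemma dominated_iter t x : dominated x -> dominated (iter t step x).
Proof. by move=> H; elim: t => // t; apply: dominated_step. Qed.

Lemma iter_step_loop x : iter k.+1 step x = x.
Proof. by rewrite iter_step expg_uturn_loop act_tuple1. Qed.

(** The exchange at the last two sites followed by the rotation relation; the rotation also turns
    the word. *)
Lemma ev_step x mu : mu \in S -> dominated x ->
  ev (step x) (Psi (act_word (cyc n) mu)) =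
  push pen (rate a pen x) (F x) mu.
Proof.
move=> hm dx; rewrite /step -act_tupleM.
have := ev_expg_cyc 1 (act_tuple (sbar pen) x) hm; rewrite !expg1 => ->.
by rewrite (exchange size_lam a01 famP) // => j; have [] := dx j.
Qed.

(** The numerator of 1 - rate is x_n (x_{n-1} - a_l) (sites numbered from 1), positive since a_l < 1
    <= x_{n-1}. *)
Lemma rate_bounds x l : dominated x -> 0 <= rate a pen x l < 1.
Proof.
move=> dx; rewrite /rate ordS_pen.
have /andP[a0 a1] := a01 l; have [x1 xm] := dx pen.
have d0 : 0 < x pen * (x ord_max - a l) by apply: mulr_gt0; lra.
by rewrite ltr_pdivrMr // divr_ge0 //=; nra.
Qed.

Lemma rate_gt0 x l : dominated x -> x pen < x ord_max -> 0 < rate a pen x l.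
Proof.
move=> dx lx; rewrite /rate ordS_pen.
have /andP[a0 a1] := a01 l; have [x1 xm] := dx pen.
by rewrite divr_gt0 ?mulr_gt0 //; lra.
Qed.

Lemma hop_bounds x mu : dominated x -> 0 <= hop pen (rate a pen x) mu < 1.
Proof.
by move=> dx; rewrite /hop; case: ifP => _; rewrite ?lexx ?ltr01 // rate_bounds.
Qed.

Section Sign.
Variable s : R.

(** Taking s = 1 and s = -1 yields the positive and the negative part of [F]. *)
Let pos x mu := Num.max (s * F x mu) 0.

Lemma pos_ge0 x mu : 0 <= pos x mu.
Proof. by rewrite /pos le_max lexx orbT. Qed.

(** The positive part is subadditive and [push] has nonnegative coefficients. *)
Lemma pos_step_le x mu : mu \in S -> dominated x ->
  pos (step x) (act_word (cyc n) mu) <= push pen (rate a pen x) (pos x) mu.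
Proof.
move=> hm dx; rewrite {1}/pos /F ev_step // /push.
have /andP[h0 h1] := hop_bounds mu dx.
have /andP[g0 g1] := hop_bounds (act_word (sbar pen) mu) dx.
move: h0 h1 g0 g1.
set h := hop _ _ mu; set g := hop _ _ _; set mu' := act_word _ _ => h0 h1 g0 g1.
have p0 := pos_ge0 x mu; have p0' := pos_ge0 x mu'.
have p1 : s * F x mu <= pos x mu by rewrite /pos le_max lexx.
have p1' : s * F x mu' <= pos x mu' by rewrite /pos le_max lexx.
rewrite ge_max; apply/andP; split; last by nra.
rewrite mulrDr !mulrA ![s * _]mulrC -!mulrA.
by apply: lerD; apply: ler_wpM2l => //; lra.
Qed.

Lemma sum_pos_step x : dominated x ->
  \sum_(mu <- S) pos (step x) mu <= \sum_(mu <- S) pos x mu.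
Proof.
move=> dx; rewrite -(reindex_words size_lam (cyc n) (pos (step x))).
rewrite -(sum_push size_lam pen (rate a pen x) (pos x)).
rewrite [leLHS]big_seq [leRHS]big_seq.
by apply: ler_sum => mu hm; apply: pos_step_le.
Qed.

Lemma sum_pos_iter t x : dominated x ->
  \sum_(mu <- S) pos (iter t step x) mu <= \sum_(mu <- S) pos x mu.
Proof.
move=> dx; elim: t => // t; apply: le_trans.
by rewrite iterS; apply/sum_pos_step/dominated_iter.
Qed.

(* [step] has finite order, so the positive parts lose no mass at any step:
   no cancellation occurs. *)
Lemma pos_step x mu : mu \in S -> dominated x ->
  pos (step x) (act_word (cyc n) mu) = push pen (rate a pen x) (pos x) mu.
Proof.
move=> hm dx.
have E : \sum_(mu <- S) pos (step x) mu = \sum_(mu <- S) pos x mu.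
  apply/eqP; rewrite eq_le sum_pos_step //=.
  by rewrite -{1}[x]iter_step_loop iterSr sum_pos_iter //; apply: dominated_step.
pose d mu := push pen (rate a pen x) (pos x) mu
  - pos (step x) (act_word (cyc n) mu).
have d0 nu : nu \in S -> 0 <= d nu by move=> hn; rewrite subr_ge0 pos_step_le.
have : \sum_(nu <- S) d nu = 0.
  rewrite sumrB (reindex_words size_lam (cyc n) (pos (step x))).
  by rewrite (sum_push size_lam) E subrr.
rewrite big_seq => /eqP; rewrite psumr_eq0 => [|nu hn]; last exact: d0.
by move=> /allP /(_ mu hm); rewrite hm /= subr_eq0 => /eqP.
Qed.

(** Rates are below 1, so some mass always stays unswapped. *)
Lemma pos_stay x mu : mu \in S -> dominated x -> 0 < pos x mu ->
  0 < pos (step x) (act_word (cyc n) mu).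
Proof.
move=> hm dx p0; rewrite pos_step // /push.
have /andP[_ h1] := hop_bounds mu dx.
have /andP[g0 _] := hop_bounds (act_word (sbar pen) mu) dx.
by rewrite ltr_pwDl ?mulr_ge0 ?pos_ge0 // mulr_gt0 // subr_gt0.
Qed.

Lemma pos_swap x mu : mu \in S -> dominated x -> x pen < x ord_max ->
  (nth 0%N mu (ord_max : 'I_n) < nth 0%N mu pen)%N -> 0 < pos x mu ->
  0 < pos (step x) (act_word (cyc n) (act_word (sbar pen) mu)).
Proof.
move=> hm dx lx d p0; have hm' := mem_act_word size_lam (sbar pen) hm.
rewrite pos_step // /push (act_word_sbarK size_lam) //.
have /andP[_ h1] := hop_bounds (act_word (sbar pen) mu) dx.
rewrite ltr_wpDl ?mulr_ge0 ?pos_ge0 ?subr_ge0 1?ltW // mulr_gt0 //.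
by rewrite /hop ordS_pen d rate_gt0.
Qed.

Lemma pos_stays t x mu : mu \in S -> dominated x -> 0 < pos x mu ->
  0 < pos (iter t step x) (act_word (cyc n ^+ t)%g mu).
Proof.
move=> hm dx p0; elim: t => [|t IH].
  by rewrite expg0 act_word1 // (size_rearr size_lam hm).
rewrite iterS expgSr -act_wordM; apply: pos_stay => //.
  exact: mem_act_word.
exact: dominated_iter.
Qed.

(** A full loop without any swap restores x but turns the word by k+1 = n-1 sites, that is, by one
    site backwards. *)
Lemma pos_rotV x mu : mu \in S -> dominated x -> 0 < pos x mu ->
  0 < pos x (act_word (cyc n ^+ k.+1)%g mu).
Proof. by move=> hm dx p0; rewrite -[x]iter_step_loop; apply: pos_stays. Qed.

Lemma pos_rot t x mu : mu \in S -> dominated x -> 0 < pos x mu ->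
  0 < pos x (act_word (cyc n ^+ t)%g mu).
Proof.
move=> hm dx p0.
have H l : 0 < pos x (act_word ((cyc n ^+ k.+1) ^+ l)%g mu).
  elim: l => [|l IH]; first by rewrite expg0 act_word1 // (size_rearr size_lam hm).
  by rewrite expgSr -act_wordM; apply: pos_rotV => //; apply: mem_act_word.
(* Backward turns generate all rotations: (k+1)^2 = k n + 1 with n = k+2. *)
suff -> : (cyc n ^+ t = (cyc n ^+ k.+1) ^+ (k.+1 * t))%g by [].
have -> : ((cyc n ^+ k.+1) ^+ (k.+1 * t) = (cyc n ^+ n) ^+ (k * t) * cyc n ^+ t)%g.
  by rewrite -!expgM -expgD; congr (_ ^+ _)%g; nia.
by rewrite expg_cyc_n expg1n mul1g.
Qed.

(** Swap at the first step of the loop, make the k remaining steps without swaps, then undo the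
    accumulated rotation by [pos_rot]. *)
Lemma pos_descent_pen x mu : mu \in S -> dominated x -> x pen < x ord_max ->
  (nth 0%N mu (ord_max : 'I_n) < nth 0%N mu pen)%N -> 0 < pos x mu ->
  0 < pos x (act_word (sbar pen) mu).
Proof.
move=> hm dx lx d p0; have hm' := mem_act_word size_lam (sbar pen) hm.
have := pos_swap hm dx lx d p0.
move=> /(pos_stays k (mem_act_word size_lam _ hm') (dominated_step dx)).
rewrite -iterSr iter_step_loop act_wordM -expgS => H.
have := pos_rot 1 (mem_act_word size_lam _ hm') dx H.
by rewrite act_wordM -expgSr expg_cyc_n act_word1 // size_act_word.
Qed.

Lemma pos_descent x mu (i : 'I_n) :
  mu \in S -> dominated x -> x pen < x ord_max -> (i.+1 < n)%N ->
  (nth 0%N mu (ordS i) < nth 0%N mu i)%N -> 0 < pos x mu ->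
  0 < pos x (act_word (sbar i) mu).
Proof.
move=> hm dx lx i1 d p0.
(* Rotation carries sites i and i+1 to the last two, where [pos_descent_pen] applies; the remaining
   n - (k - i) turns undo it. *)
set w := (cyc n ^+ (k - i))%g.
have wi : w i = pen.
  apply/ord_inj; rewrite expg_cyc inordK // subnKC; last by lia.
  by rewrite modn_small.
have wSi : w (ordS i) = ord_max.
  rewrite -ordS_pen -wi /w; apply/ord_inj; rewrite /= !expg_cyc /=.
  by rewrite modnDml -[in RHS]addn1 modnDml addn1 addSn.
have hw := mem_act_word size_lam w hm.
have pw : 0 < pos x (act_word w mu) by apply: pos_rot.
have dw : (nth 0%N (act_word w mu) (ord_max : 'I_n) <
    nth 0%N (act_word w mu) pen)%N.
  by rewrite !nth_act_word -wi -wSi !permK.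
have := pos_descent_pen hw dx lx dw pw.
move=> /(pos_rot (n - (k - i)) (mem_act_word size_lam _ hw) dx).
rewrite !act_wordM; congr (0 < pos x (act_word _ mu)).
have -> : (cyc n ^+ (n - (k - i)) = w^-1)%g.
  apply/eqP; rewrite eq_sym eq_invg_mul -expgD subnKC ?expg_cyc_n //; lia.
by rewrite /sbar ordS_pen -wi -wSi -tpermJ conjgE !mulgA mulgV mul1g mulgK.
Qed.

Lemma pos_sorted x mu : mu \in S -> dominated x -> x pen < x ord_max ->
  0 < pos x mu -> 0 < pos x lam.
Proof.
move=> hm dx lx; apply: (sort_descents size_lam (Q := fun nu => 0 < pos x nu)) hm => //.
by move=> nu i hn p0 i1 d; apply: pos_descent.
Qed.

End Sign.

Definition definite (x : 'I_n -> R) :=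
  (forall mu, mu \in S -> 0 <= ev x (Psi mu)) \/
  (forall mu, mu \in S -> ev x (Psi mu) <= 0).

(** A positive and a negative value would each propagate to [lam], where [F] would then have both
    signs. *)
Lemma definite_pen x : dominated x -> x pen < x ord_max -> definite x.
Proof.
move=> dx lx; apply: contrapT => /not_orP[].
move=> /existsNP[mu /not_implyP[hm /negP]]; rewrite -ltNge => Fm.
move=> /existsNP[nu /not_implyP[hn /negP]]; rewrite -ltNge => Fn.
have := pos_sorted (s := -1) hm dx lx; have := pos_sorted (s := 1) hn dx lx.
rewrite /F !lt_max !ltxx !orbF !mul1r !mulN1r !oppr_gt0 => /(_ Fn) + /(_ Fm).
by move=> /lt_trans H /H; rewrite ltxx.
Qed.

Lemma definite_step x : dominated x -> definite x -> definite (step x).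
Proof.
move=> dx.
have W mu : mu \in S -> exists2 nu, nu \in S & mu = act_word (cyc n) nu.
  move=> hm; exists (act_word (cyc n)^-1%g mu); first exact: mem_act_word.
  by rewrite (act_wordK size_lam) ?mulVg.
have B mu := hop_bounds mu dx.
case=> H; [left|right] => _ /W[nu hn ->]; rewrite ev_step // /push /F.
all: have hn' := mem_act_word size_lam (sbar pen) hn.
all: have /andP[h0 h1] := B nu; have /andP[g0 g1] := B (act_word (sbar pen) nu).
- by rewrite addr_ge0 // mulr_ge0 ?H //; lra.
- by rewrite -oppr_ge0 opprD -!mulrN addr_ge0 // mulr_ge0 ?oppr_ge0 ?H //; lra.
Qed.

Lemma definite_iter t x : dominated x -> definite x -> definite (iter t step x).
Proof.
by move=> dx d; elim: t => // t; rewrite iterS; apply/definite_step/dominated_iter.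
Qed.

(** After k - j steps the smaller entry stands next to the last site and [definite_pen] applies; the
    rest of the loop leads back to x and preserves definiteness. *)
Lemma definite_dominated x j : dominated x -> x j < x ord_max -> definite x.
Proof.
move=> dx lx.
have jk : (j < k.+1)%N.
  rewrite ltn_neqAle -ltnS ltn_ord andbT; apply: contraTneq lx => e.
  by rewrite (_ : j = ord_max) ?ltxx //; apply/ord_inj.
have -> : x = iter (k.+1 - (k - j)) step (iter (k - j) step x).
  by rewrite -iterD subnK ?iter_step_loop //; lia.
apply: definite_iter; first exact: dominated_iter.
apply: definite_pen; first exact: dominated_iter.
rewrite iter_step /act_tuple -{1}(expg_uturn_max (k - j)) permK.
suff <- : (uturn ^+ (k - j))%g j = pen by rewrite permK.
by apply/ord_inj; rewrite expg_uturn // inordK // subnKC ?modn_small //; lia.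
Qed.

Lemma definite_max x m j : (forall l, 1 <= x l /\ x l <= x m) -> x j < x m ->
  definite x.
Proof.
move=> dx lx; pose w := (cyc n ^+ (k.+1 - m))%g.
have wm : w m = ord_max.
  apply/ord_inj; rewrite expg_cyc subnKC ?modn_small //.
  by have := ltn_ord m; lia.
have wmV : (w^-1)%g ord_max = m by rewrite -wm permK.
have : definite (act_tuple w x).
  apply: (@definite_dominated _ (w j)); last by rewrite /act_tuple wmV permK.
  by move=> l; rewrite /act_tuple wmV; apply: dx.
by case=> H; [left|right] => mu hm; rewrite -(ev_expg_cyc (k.+1 - m)) //;
  apply/H/mem_act_word.
Qed.

Lemma ev_div_Pi_bounds x m j mu : (forall l, 1 <= x l /\ x l <= x m) ->
  x j < x m -> mu \in S ->
  0 <= ev x (Psi mu) / Pi_ev lam Psi x <= 1.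
Proof.
move=> dx lx hm.
have E : Pi_ev lam Psi x =
    ev x (Psi mu) + \sum_(nu <- S | nu != mu) ev x (Psi nu).
  by rewrite /Pi_ev (bigD1_seq mu) ?permutations_uniq.
(* If [Pi] vanishes, the quotient is 0 by the convention for division by 0. *)
have [P0|P0] := eqVneq (Pi_ev lam Psi x) 0; first by rewrite P0 invr0 mulr0 lexx ler01.
have [H|H] := definite_max dx lx; have Hm := H _ hm.
- have s0 : 0 <= \sum_(nu <- S | nu != mu) ev x (Psi nu).
    by rewrite big_seq_cond; apply: sumr_ge0 => nu /andP[/H].
  have P1 : 0 < Pi_ev lam Psi x by rewrite lt_neqAle eq_sym P0 E addr_ge0.
  by rewrite divr_ge0 ?(ltW P1) //= ler_pdivrMr // mul1r E; lra.
- have s0 : \sum_(nu <- S | nu != mu) ev x (Psi nu) <= 0.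
    by rewrite big_seq_cond; apply: sumr_le0 => nu /andP[/H].
  have P1 : Pi_ev lam Psi x < 0 by rewrite lt_neqAle P0 E; lra.
  have -> : ev x (Psi mu) / Pi_ev lam Psi x =
      (- ev x (Psi mu)) / (- Pi_ev lam Psi x) by rewrite invrN mulrNN.
  have P2 : 0 < - Pi_ev lam Psi x by rewrite oppr_gt0.
  rewrite divr_ge0 ?oppr_ge0 ?(ltW P1) //=.
  by rewrite ler_pdivrMr // mul1r E; lra.
Qed.

End Positivity.

Lemma ev_ratio_bounds (n : nat) (R : realType) (a : nat -> R) (lam : seq nat)
    (Psi : seq nat -> mpoly.mpoly n R) : (1 < n)%N -> size lam = n ->
  sorted leq lam -> (forall l, 0 < a l < 1) -> is_iTASEP_family a lam Psi ->
  forall (x : 'I_n -> R) (m j : 'I_n) mu,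
  (forall l, 1 <= x l /\ x l <= x m) -> x j < x m ->
  mu \in permutations lam ->
  0 <= ev x (Psi mu) / Pi_ev lam Psi x <= 1.
Proof.
case: n Psi => [|[|k]] Psi // _ sz slam a01 famP x m j mu.
exact: (ev_div_Pi_bounds sz slam a01 famP).
Qed.

(** * Lists up to rotation *)

Lemma eq_in_map_filter (T : eqType) (T' : Type) (f g : T -> T') (P Q : pred T)
    (s : seq T) : {in s, f =1 g} -> {in s, P =1 Q} ->
  [seq f x | x <- s & P x] = [seq g x | x <- s & Q x].
Proof.
move=> fg PQ; rewrite (eq_in_filter PQ); apply/eq_in_map => x.
by rewrite mem_filter => /andP[_ /fg].
Qed.

Section Rotations.
Implicit Types s t u : seq nat.

Lemma cyc_eqP s t : reflect (exists k, s = rot k t) (cyc_eq s t).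
Proof.
apply: (iffP hasP) => [[k _ /eqP ->]|[k ->]]; first by exists k.
have [kt|tk] := leqP k (size t); first by exists k; rewrite ?mem_iota ?ltnS.
by exists 0%N; rewrite ?mem_iota // rot0 rot_oversize // ltnW.
Qed.

Lemma cyc_eq_sym s t : cyc_eq s t -> cyc_eq t s.
Proof.
move=> /cyc_eqP[k ->]; apply/cyc_eqP; exists (size (rot k t) - k)%N.
by rewrite -/(rotr _ _) rotK.
Qed.

Lemma cyc_eq_trans s t u : cyc_eq s t -> cyc_eq t u -> cyc_eq s u.
Proof.
move=> /cyc_eqP[k ->] /cyc_eqP[l ->]; apply/cyc_eqP.
by rewrite rot_rot_add; eexists.
Qed.

Lemma cyc_eq_filter_rot (T : Type) (P : pred T) (g : T -> nat) i (s : seq T) :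
  cyc_eq [seq g j | j <- rot i s & P j] [seq g j | j <- s & P j].
Proof.
(* The filtered list turns by the number of kept entries among the first i. *)
apply/cyc_eqP; exists (size (seq.filter P (take i s))).
have -> : seq.filter P s = seq.filter P (take i s) ++ seq.filter P (drop i s).
  by rewrite -filter_cat cat_take_drop.
by rewrite -map_rot rot_size_cat -filter_cat.
Qed.

End Rotations.

(** Reading the ring from site i puts i and its successor at the head, also when i is the last site
    and the successor wraps to 0. *)
Lemma rot_enum_ord n (i : 'I_n) : (1 < n)%N ->
  exists e, rot i (enum 'I_n) = i :: ordS i :: e.
Proof.
move=> n1; have sz := size_enum_ord n.
rewrite /rot (drop_nth i) ?sz // nth_ord_enum.
have [iS|iS] := ltnP i.+1 n.
  rewrite (drop_nth i) ?sz //; eexists; congr (_ :: (_ :: _)).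
  by apply/ord_inj; rewrite nth_enum_ord //= modn_small.
have ei : i.+1 = n by apply/eqP; rewrite eqn_leq iS ltn_ord.
rewrite drop_oversize ?sz //= -(drop0 (enum 'I_n)) (drop_nth i) ?sz ?(ltnW n1) //.
have -> : nat_of_ord i = n.-2.+1 by lia.
eexists; congr (_ :: (_ :: _)).
by apply/ord_inj; rewrite nth_enum_ord ?(ltnW n1) //= ei modnn.
Qed.

(** * Stone configurations and the auxiliary TASEP *)

Section Stones.
Variables (n : nat) (rho : 'I_n -> nat).
Hypothesis n1 : (1 < n)%N.

(** Read from site i, the swap exchanges the first two stones. At most one of them has density d, so
    the filtered list does not change. *)
Lemma stones_along_sbar d (sigma : 'S_n) (i : 'I_n) :
  rho (sigma^-1%g i) != rho (sigma^-1%g (ordS i)) ->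
  cyc_eq (stones_along rho d (sigma * sbar i)%g) (stones_along rho d sigma).
Proof.
move=> ne; rewrite /stones_along.
pose L (s : 'S_n) := [seq nat_of_ord (s^-1%g j) | j <- rot i (enum 'I_n) &
  rho (s^-1%g j) == d].
have HL s : cyc_eq (L s) (stones_along rho d s) by apply: cyc_eq_filter_rot.
suff E : L (sigma * sbar i)%g = L sigma.
  by apply: cyc_eq_trans (cyc_eq_sym (HL _)) _; rewrite E; apply: HL.
have [e He] := rot_enum_ord i n1.
have : uniq (rot i (enum 'I_n)) by rewrite rot_uniq enum_uniq.
rewrite He /= inE negb_or => /and3P[/andP[_ ie] Se _].
rewrite /L He -[i :: _]/([:: i; ordS i] ++ e) !filter_cat !map_cat.
set v := ((sigma * sbar i)^-1)%g.
have vE j : v j = sigma^-1%g (sbar i j) by rewrite /v invMg permM tpermV.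
congr cat.
  rewrite /= !vE tpermL tpermR.
  have [e1|_] := eqVneq (rho (sigma^-1%g i)) d;
    have [e2|_] := eqVneq (rho (sigma^-1%g (ordS i))) d;
    rewrite /= ?vE ?tpermL ?tpermR //.
  by rewrite e1 e2 eqxx in ne.
have H j : j \in e -> v j = sigma^-1%g j.
  move=> je; rewrite vE tpermD //.
    by apply: contraNneq ie => ->.
  by apply: contraNneq Se => ->.
by apply: eq_in_map_filter => j /H ->.
Qed.

Lemma Omega_sbar (sigma : 'S_n) (i : 'I_n) :
  rho (sigma^-1%g i) != rho (sigma^-1%g (ordS i)) ->
  sigma \in Omega rho -> (sigma * sbar i)%g \in Omega rho.
Proof.
move=> ne; rewrite !inE => /andP[h1 h2].
by apply/andP; split; apply: cyc_eq_trans (stones_along_sbar _ ne) _.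
Qed.

Lemma Omega1 : 1%g \in Omega rho.
Proof.
have H d : cyc_eq (stones_along rho d 1%g) (stones_of rho d).
  rewrite (_ : stones_along rho d 1%g = stones_of rho d).
    by apply/cyc_eqP; exists 0%N; rewrite rot0.
  rewrite /stones_along /stones_of.
  under eq_map do rewrite invg1 perm1.
  by congr map; apply: eq_filter => j; rewrite invg1 perm1.
by rewrite inE !H.
Qed.

Lemma up_sbar (sigma : 'S_n) (i : 'I_n) : up rho (sigma * sbar i)%g i =
  (rho (sigma^-1%g (ordS i)) < rho (sigma^-1%g i))%N.
Proof. by rewrite /up !invMg !permM !tpermV tpermL tpermR. Qed.

Hypothesis rho12 : forall j, (rho j == 1)%N || (rho j == 2)%N.

(** The left side counts density descents of [sigma]. With densities 1 and 2, the density change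
    from i to i+1 is the ascent indicator minus the descent indicator, and these changes sum to 0
    around the ring. *)
Lemma card_up_sbar (sigma : 'S_n) :
  #|[set i | up rho (sigma * sbar i)%g i]%SET| = Kfrak rho sigma.
Proof.
pose f i := rho (sigma^-1%g i).
have H : (\sum_(i < n) (up rho sigma i + f i) =
    \sum_(i < n) (up rho (sigma * sbar i)%g i + f (ordS i)))%N.
  apply: eq_bigr => i _; rewrite up_sbar /up /f.
  by case/orP: (rho12 (sigma^-1%g i)) => /eqP ->;
     case/orP: (rho12 (sigma^-1%g (ordS i))) => /eqP ->.
have H' : (\sum_(i < n) f (ordS i) = \sum_(i < n) f i)%N.
  by rewrite [RHS](reindex_inj (@ordS_inj n)).
move: H; rewrite !big_split /= H' => /addIn H.
have cE (P : pred 'I_n) : #|[set i | P i]%SET| = (\sum_(i < n) P i)%N.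
  by rewrite -sum1dep_card big_mkcond; apply: eq_bigr => i _; case: (P i).
by rewrite /Kfrak !cE.
Qed.

End Stones.

(** * Limits of ratios of polynomials at infinity *)

Section PolynomialLimits.
Variable R : realType.

Lemma cvg_inv_pinfty : r^-1 @[r --> +oo] --> (0 : R).
Proof.
apply/(cvgrVy (f := fun r : R => r^-1)).
  by near=> r; rewrite invr_gt0; near: r; exact: nbhs_pinfty_gt.
have -> : (unstable.inv_fun (fun r : R => r^-1)) = id.
  by apply/funext => r /=; rewrite invrK.
exact: cvg_id.
Unshelve. all: by end_near.
Qed.

(** q(r) / r^d is the reversed polynomial [q'] at 1/r, which is continuous at 0. *)
Lemma cvg_horner_pow (q : {poly R}) d : (size q <= d.+1)%N ->
  q.[r] / r ^+ d @[r --> +oo] --> q`_d.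
Proof.
move=> sq; pose q' := \poly_(i < d.+1) q`_(d - i).
have q'0 : q'.[0] = q`_d by rewrite horner_coef0 coef_poly /= subn0.
rewrite -q'0; apply: (@cvg_trans _ (q'.[r^-1] @[r --> +oo])); last first.
  apply: (cvg_comp (fun r : R => r^-1) (horner q')); first exact: cvg_inv_pinfty.
  exact: continuous_horner.
apply: near_eq_cvg; near=> r.
have r0 : r != 0 by apply: lt0r_neq0; near: r; exact: nbhs_pinfty_gt.
rewrite (horner_coef_wide r sq) horner_poly mulr_suml.
rewrite (reindex_inj rev_ord_inj) /=; apply: eq_bigr => i _.
have id : (i <= d)%N by rewrite -ltnS.
have -> : r ^+ d = r ^+ (d - i) * r ^+ i by rewrite -exprD subnK.
by rewrite subSS exprVn invfM mulrA subKn // [RHS]mulrAC mulfK // expf_neq0.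
Unshelve. all: by end_near.
Qed.

(** The bound forces deg f <= deg g: otherwise, dividing |f| <= |g| by r^(deg f) gives in the limit
    that the leading coefficient of f is 0. *)
Lemma cvg_horner_ratio (f g : {poly R}) :
  (\forall r \near +oo, g.[r] != 0) ->
  (\forall r \near +oo, `|f.[r] / g.[r]| <= 1) ->
  cvg (f.[r] / g.[r] @[r --> +oo]).
Proof.
move=> g0 fg.
have gn0 : g != 0.
  apply/eqP => e; have [r] := filter_ex g0.
  by rewrite e horner0 eqxx.
set d := (size g).-1.
have sg : size g = d.+1 by rewrite prednK // size_poly_gt0.
have [sf|sf] := leqP (size f) d.+1.
  apply/cvg_ex; exists (f`_d / g`_d).
  have gd : g`_d != 0 by rewrite -lead_coefE lead_coef_eq0.
  apply: (@cvg_trans _ (f.[r] / r ^+ d / (g.[r] / r ^+ d) @[r --> +oo])).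
    apply: near_eq_cvg; near=> r.
    have r0 : r != 0 by apply: lt0r_neq0; near: r; exact: nbhs_pinfty_gt.
    have gr : g.[r] != 0 by near: r.
    by field; rewrite gr expf_neq0.
  apply: cvgM; first exact: cvg_horner_pow.
  by apply: cvgV => //; apply: cvg_horner_pow; rewrite sg.
exfalso; set e := (size f).-1.
have se : size f = e.+1 by rewrite prednK // (leq_trans _ sf).
have fe : f`_e != 0.
  by rewrite -lead_coefE lead_coef_eq0 -size_poly_gt0 se.
have ge : g`_e = 0 by rewrite nth_default // sg -ltnS -se.
have cf : `|f.[r] / r ^+ e| @[r --> +oo] --> `|f`_e|.
  by apply: cvg_norm; apply: cvg_horner_pow; rewrite se.
have cg : `|g.[r] / r ^+ e| @[r --> +oo] --> (0 : R).
  by rewrite -(normr0 R) -ge; apply: cvg_norm; apply: cvg_horner_pow; rewrite sg -se ltnW.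
have : `|f`_e| <= 0.
  apply: ler_cvg_to cf cg _; near=> r.
  rewrite !normrM ler_wpM2r //.
  have gr : 0 < `|g.[r]| by rewrite normr_gt0; near: r.
  rewrite -[leRHS]mul1r -ler_pdivrMr // -normfV -normrM.
  by near: r.
by rewrite normr_le0 (negPf fe).
Unshelve. all: by end_near.
Qed.

Lemma ev_horner n (x : 'I_n -> {poly R}) (f : mpoly.mpoly n R) :
  exists g : {poly R}, forall r, ev (fun j => (x j).[r]) f = g.[r].
Proof.
exists (\sum_(m <- mpoly.msupp f)
  mpoly.mcoeff m f *: \prod_i x i ^+ mpoly.fun_of_multinom m i) => r.
rewrite /ev mpoly.mevalE horner_sum; apply: eq_bigr => m _.
rewrite hornerZ horner_prod; congr (_ * _).
by apply: eq_bigr => i _; rewrite horner_exp.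
Qed.

End PolynomialLimits.

(** * The limiting ratios and the balance equation *)

Section Stationarity.
Variables (R : realType) (n : nat) (a : nat -> R) (lam : seq nat).
Variables (rho : 'I_n -> nat) (p : 'I_n -> R) (Psi : seq nat -> mpoly.mpoly n R).
Hypothesis n1 : (1 < n)%N.
Hypothesis a01 : forall k, 0 < a k < 1.
Hypothesis size_lam : size lam = n.
Hypothesis sorted_lam : sorted leq lam.
Hypothesis rho12 : forall j, (rho j == 1)%N || (rho j == 2)%N.
Hypothesis rho_last : forall j : 'I_n, nat_of_ord j = n.-1 -> rho j = 2%N.
Hypothesis p01 : forall j, rho j = 1%N -> 0 <= p j < 1.
Hypothesis p_gt0 : exists j, rho j = 1%N /\ 0 < p j.
Hypothesis famP : is_iTASEP_family a lam Psi.
Hypothesis Pi_neq0 : \forall r \near +oo, Pi_ev lam Psi (chi rho p r) != 0.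

Let S := permutations lam.

Definition ratio (mu : seq nat) (sigma : 'S_n) (r : R) : R :=
  ev (act_tuple sigma (chi rho p r)) (Psi mu) / Pi_ev lam Psi (chi rho p r).

Definition ratio_lim (mu : seq nat) (sigma : 'S_n) : R :=
  lim (ratio mu sigma r @[r --> +oo]).

Lemma near_chi : \forall r \near +oo,
  (forall j, 1 <= chi rho p r j /\ chi rho p r j <= r)
  /\ exists j, chi rho p r j < r.
Proof.
near=> r.
(* This threshold exceeds 1 and every [(p j)^-1]; absolute values are taken because [p] has no
   prescribed sign at stones of density 2. *)
have rB : 1 + \sum_j `|(p j)^-1| < r.
  by near: r; apply: nbhs_pinfty_gt; rewrite num_real.
have s0 : 0 <= \sum_j `|(p j)^-1| by apply: sumr_ge0.
have rp j : (p j)^-1 < r.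
  apply: le_lt_trans rB; rewrite (bigD1 j) //=.
  have := ler_norm (p j)^-1; have : 0 <= \sum_(i | i != j) `|(p i)^-1|.
    by apply: sumr_ge0.
  lra.
split=> [j|]; last first.
  by have [j [r1 pj]] := p_gt0; exists j; rewrite /chi r1 pj /= rp.
rewrite /chi; case: ifP => [/andP[/eqP /p01 /andP[_ pj1] pj0]|_]; last by lra.
by split; [rewrite invf_ge1 ?ltW|rewrite ltW].
Unshelve. all: by end_near.
Qed.

Lemma near_act_chi (sigma : 'S_n) : \forall r \near +oo,
  forall j, 1 <= act_tuple sigma (chi rho p r) j.
Proof.
by apply: filterS near_chi => r [H _] j; have [] := H (sigma^-1%g j).
Qed.

(** By symmetry [Pi] may be taken at the permuted point too. The maximum r of that point sits under
    the last stone, of density 2, and a stone with p > 0 has a smaller entry. *)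
Lemma near_ratio (sigma : 'S_n) : \forall r \near +oo,
  forall mu, mu \in S -> 0 <= ratio mu sigma r <= 1.
Proof.
apply: filterS near_chi => r [H [j lj]].
move=> mu hm; have nlt : (n.-1 < n)%N by lia.
pose m := Ordinal nlt.
have cm : chi rho p r m = r by rewrite /chi rho_last.
rewrite /ratio -(Pi_ev_perm size_lam a01 famP sigma); last by move=> l; have [] := H l.
apply: (@ev_ratio_bounds n R a lam Psi n1 size_lam sorted_lam a01 famP _
  (sigma m) (sigma j)) => // [l|]; rewrite /act_tuple !permK cm //.
Qed.

Lemma cvg_ratio mu sigma : mu \in S ->
  ratio mu sigma r @[r --> +oo] --> ratio_lim mu sigma.
Proof.
move=> hm.
(* The entries of [chi] are polynomials in r, so numerator and denominator are too. *)
pose c j : {poly R} := if (rho j == 1%N) && (0 < p j) then ((p j)^-1)%:P else 'X.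
have cE r j : (c j).[r] = chi rho p r j.
  by rewrite /c /chi; case: ifP => _; rewrite ?hornerC ?hornerX.
have [f Hf] := ev_horner (fun j => c (sigma^-1%g j)) (Psi mu).
have /choice[G HG] nu : exists g : {poly R}, forall r,
  ev (fun j => (c j).[r]) (Psi nu) = g.[r] by apply: ev_horner.
pose g := \sum_(nu <- S) G nu.
have fE r : ev (act_tuple sigma (chi rho p r)) (Psi mu) = f.[r].
  by rewrite -Hf; congr ev; apply/funext => j; rewrite cE.
have gE r : Pi_ev lam Psi (chi rho p r) = g.[r].
  rewrite /g horner_sum; apply: eq_bigr => nu _; rewrite -HG; congr ev.
  by apply/funext => j; rewrite cE.
have E : ratio mu sigma = fun r => f.[r] / g.[r].
  by apply/funext => r; rewrite /ratio fE gE.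
rewrite /ratio_lim E; apply: cvg_horner_ratio.
  by apply: filterS Pi_neq0 => r; rewrite gE.
apply: filterS (near_ratio sigma) => r /(_ mu hm).
by rewrite E => /andP[h0 h1]; rewrite ger0_norm.
Qed.

Lemma ratio_lim_ge0 mu sigma : mu \in S -> 0 <= ratio_lim mu sigma.
Proof.
move=> hm; apply: (@cvgr_to_ge _ _ _ _ _ _ _ (cvg_ratio (sigma := sigma) hm)).
by apply: filterS (near_ratio sigma) => r /(_ mu hm) /andP[].
Qed.

Lemma sum_ratio_lim sigma : \sum_(mu <- S) ratio_lim mu sigma = 1.
Proof.
have c : \sum_(mu <- S) ratio mu sigma r @[r --> +oo] -->
    \sum_(mu <- S) ratio_lim mu sigma.
  rewrite [X in _ --> X]big_seq.
  under eq_fun do rewrite big_seq.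
  by apply: cvg_big => [|mu hm]; [exact: add_continuous|exact: cvg_ratio].
apply: (@norm_cvg_unique _ _ (\sum_(mu <- S) ratio mu sigma r @[r --> +oo])) c _.
apply: cvg_near_cst; near=> r.
have Pi0 : Pi_ev lam Psi (chi rho p r) != 0 by near: r.
rewrite -mulr_suml -/(Pi_ev lam Psi _) (Pi_ev_perm size_lam a01 famP) ?divff //.
move=> j; rewrite -[chi rho p r]act_tuple1.
by move: j; near: r; exact: near_act_chi.
Unshelve. all: by end_near.
Qed.

Lemma up_rho sigma i : up rho sigma i ->
  rho (sigma^-1%g i) = 1%N /\ rho (sigma^-1%g (ordS i)) = 2%N.
Proof.
rewrite /up; case/orP: (rho12 (sigma^-1%g i)) => /eqP ->;
  by case/orP: (rho12 (sigma^-1%g (ordS i))) => /eqP ->.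
Qed.

Definition stone_rate (sigma : 'S_n) (i : 'I_n) (l : nat) : R :=
  p (sigma^-1%g i) * a l.

Lemma cvg_rate sigma i l : up rho sigma i ->
  rate a i (act_tuple sigma (chi rho p r)) l @[r --> +oo] -->
  stone_rate sigma i l.
Proof.
move=> /up_rho[r1 r2]; rewrite /rate /act_tuple /stone_rate.
set j := sigma^-1%g i in r1 *; have /andP[pj0 _] := p01 r1.
have E r : chi rho p r (sigma^-1%g (ordS i)) = r by rewrite /chi r2.
under eq_fun do rewrite E /chi r1 eqxx /=.
(* If p_j = 0, both sites carry the entry r and the rate is identically 0. *)
move: pj0; rewrite le_eqVlt => /predU1P[<-|pj0].
  by rewrite ltxx mul0r; under eq_fun do rewrite subrr mulr0 mul0r; apply: cvg_cst.
rewrite pj0 (_ : p j * a l = p j * a l * (1 / 1)); last by rewrite divr1 mulr1.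
have lin b : (r - b) / r @[r --> +oo] --> (1 : R).
  have := @cvg_horner_pow R ('X - b%:P) 1%N.
  rewrite size_XsubC => /(_ isT); rewrite coefB coefX coefC /= subr0.
  by under eq_fun do rewrite hornerXsubC expr1.
apply: (@cvg_trans _ (p j * a l * (((r - (p j)^-1) / r) / ((r - a l) / r))
  @[r --> +oo])); last first.
  by apply: cvgM; [exact: cvg_cst|apply: cvgM => //; apply: cvgV => //; exact: oner_neq0].
apply: near_eq_cvg; near=> r; clear r1 r2.
have r1' : 1 < r by near: r; exact: nbhs_pinfty_gt.
have /andP[a0 a1] := a01 l.
have ra : r - a l != 0 by rewrite subr_eq0; lra.
have r0 : r != 0 by lra.
have pn0 : p j != 0 by lra.
by field; rewrite ra r0 pn0.
Unshelve. all: by end_near.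
Qed.

(** The limit of [exchange]: swapping the two stones moves the word exactly as the chain does. *)
Lemma ratio_lim_sbar sigma i mu : up rho sigma i -> mu \in S ->
  ratio_lim mu (sigma * sbar i)%g =
  push i (stone_rate sigma i) (ratio_lim^~ sigma) mu.
Proof.
move=> u hm; apply: cvg_lim => //.
have hm' := mem_act_word size_lam (sbar i) hm.
pose x r := act_tuple sigma (chi rho p r).
apply: (@cvg_trans _ (push i (rate a i (x r)) (fun nu => ratio nu sigma r) mu
  @[r --> +oo])).
  apply: near_eq_cvg; near=> r.
  rewrite /ratio -act_tupleM (exchange size_lam a01 famP) //.
    by rewrite /push -/(x r); ring.
  by near: r; exact: near_act_chi.
have ch nu : hop i (rate a i (x r)) nu @[r --> +oo] --> hop i (stone_rate sigma i) nu.
  by rewrite /hop; case: ifP => _; [exact: cvg_rate|exact: cvg_cst].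
rewrite /push; apply: cvgD; apply: cvgM => //; try exact: cvg_ratio.
by apply: cvgB => //; exact: cvg_cst.
Unshelve. all: by end_near.
Qed.

Definition hop_kernel (i : 'I_n) (q : nat -> R) (mu nu : seq nat) : R :=
  (if nu == mu then 1 - hop i q mu else 0)
  + (if nu == act_word (sbar i) mu then hop i q mu else 0).

Lemma sum_hop_kernel i q v nu : nu \in S ->
  \sum_(mu <- S) v mu * hop_kernel i q mu nu = push i q v nu.
Proof.
move=> hn; have hn' := mem_act_word size_lam (sbar i) hn.
rewrite /push -(sum_words_eq (fun mu => (1 - hop i q mu) * v mu) hn).
rewrite -(sum_words_eq (fun mu => hop i q mu * v mu) hn') -big_split /=.
apply: eq_big_seq => mu hm; rewrite /hop_kernel (act_word_eqC size_lam) // (eq_sym mu).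
by case: ifP => _; case: ifP => _; ring.
Qed.

(** The case split on descents of the word disappears because [hop] is 0 off descents. *)
Lemma transE mu sigma mu' sigma' : trans rho a p mu sigma mu' sigma' =
  (if sigma' == sigma then
     if mu' == mu then 1 - (Kfrak rho sigma)%:R / n%:R else 0 else 0)
  + \sum_(i | up rho sigma i) (if sigma' == (sigma * sbar i)%g then
      n%:R^-1 * hop_kernel i (stone_rate sigma i) mu mu' else 0).
Proof.
rewrite /trans; congr (_ + _); first by do 2 case: eqP.
apply: eq_bigr => i _; rewrite /hop_kernel /hop /stone_rate.
case: (sigma' == _); rewrite ?andbT ?andbF;
  by do ?[case: ifP => _]; ring.
Qed.

(** By [ratio_lim_sbar] read backwards, each stone swap leading to [sigma'] contributes the limit at
    [sigma'] itself, with weight 1/n. *)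
Lemma sum_ratio_trans sigma mu' sigma' : mu' \in S ->
  \sum_(mu <- S) ratio_lim mu sigma * trans rho a p mu sigma mu' sigma' =
  (if sigma' == sigma then
     (1 - (Kfrak rho sigma')%:R / n%:R) * ratio_lim mu' sigma' else 0)
  + \sum_(i : 'I_n) (if up rho sigma i && (sigma' == (sigma * sbar i)%g) then
      n%:R^-1 * ratio_lim mu' sigma' else 0).
Proof.
move=> hm'; under eq_bigr do rewrite transE mulrDr mulr_sumr.
rewrite big_split /= exchange_big /=.
rewrite -[X in _ = _ + X]big_mkcond [X in _ = _ + X]big_mkcondr /=.
congr (_ + _).
  case: eqP => [->|_]; last by rewrite big1 // => mu _; rewrite mulr0.
  rewrite -(sum_words_eq (fun mu => (1 - (Kfrak rho sigma)%:R / n%:R)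
    * ratio_lim mu sigma) hm').
  by apply: eq_bigr => mu _; case: ifP => _; rewrite ?mulr0 // mulrC.
apply: eq_bigr => i u.
case: eqP => [->|_]; last by rewrite big1 // => mu _; rewrite mulr0.
rewrite (ratio_lim_sbar u hm') -(sum_hop_kernel i _ _ hm') mulr_sumr.
by apply: eq_bigr => mu _; rewrite mulrCA.
Qed.

(** The swaps into [sigma'] correspond to its density descents, as many as its ascents by
    [card_up_sbar]; they restore the mass K/n missing from the holding probability. *)
Lemma ratio_lim_stationary mu' sigma' : mu' \in S -> sigma' \in Omega rho ->
  \sum_(sigma in Omega rho) \sum_(mu <- S)
    ratio_lim mu sigma * trans rho a p mu sigma mu' sigma' =
  ratio_lim mu' sigma'.
Proof.
move=> hm' hs'; under eq_bigr do rewrite sum_ratio_trans //.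
rewrite big_split /= exchange_big /=.
rewrite -big_mkcondr (big_pred1 sigma') => [|s]; last first.
  by rewrite /= eq_sym; case: eqP => [->|]; rewrite ?hs' ?andbF.
have H i : \sum_(sigma in Omega rho)
    (if up rho sigma i && (sigma' == (sigma * sbar i)%g) then
       n%:R^-1 * ratio_lim mu' sigma' else 0) =
    if up rho (sigma' * sbar i)%g i then n%:R^-1 * ratio_lim mu' sigma' else 0.
  have eqs s : (sigma' == (s * sbar i)%g) = (s == (sigma' * sbar i)%g).
    by apply/eqP/eqP => ->; rewrite -mulgA tperm2 mulg1.
  have [u|u] := boolP (up rho (sigma' * sbar i)%g i).
    rewrite -big_mkcondr (big_pred1 (sigma' * sbar i)%g) // => s /=.
    rewrite eqs; case: eqP => [->|]; rewrite ?andbF // u !andbT.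
    apply: Omega_sbar => //; move: u; rewrite up_sbar.
    by rewrite neq_ltn => ->; rewrite orbT.
  rewrite big1 // => s _; case: ifP => // /andP[us]; rewrite eqs => /eqP es.
  by rewrite -es us in u.
under [X in _ + X]eq_bigr do rewrite H.
rewrite -big_mkcond sumr_const.
have -> : #|[pred i | up rho (sigma' * sbar i)%g i]| = Kfrak rho sigma'.
  by rewrite -(card_up_sbar rho12) cardsE.
have n0 : n%:R != 0 :> R by rewrite pnatr_eq0; lia.
by rewrite -mulr_natl; field.
Qed.

End Stationarity.

Theorem theorem6p1 (R : realType) (n : nat) (a : nat -> R) (lam : seq nat)
    (rho : 'I_n -> nat) (p : 'I_n -> R) (Psi : seq nat -> mpoly.mpoly n R) :
  (1 < n)%N ->
  (forall k, 0 < a k < 1) ->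
  size lam = n -> sorted leq lam ->
  (forall i j : 'I_n, (i <= j)%N -> (rho i <= rho j)%N) ->
  (forall j, (rho j == 1)%N || (rho j == 2)%N) ->
  (forall j : 'I_n, nat_of_ord j = 0%N -> rho j = 1%N) ->
  (forall j : 'I_n, nat_of_ord j = n.-1 -> rho j = 2%N) ->
  (forall j, rho j = 1%N -> 0 <= p j < 1) ->
  (exists j, rho j = 1%N /\ 0 < p j) ->
  is_iTASEP_family a lam Psi ->
  (\forall r \near +oo, Pi_ev lam Psi (chi rho p r) != 0) ->
  exists L : seq nat -> 'S_n -> R,
    (forall mu sigma, mu \in permutations lam -> sigma \in Omega rho ->
       ev (act_tuple sigma (chi rho p r)) (Psi mu)
         / Pi_ev lam Psi (chi rho p r) @[r --> +oo] --> L mu sigma)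
    /\ is_stationary_distribution rho a p lam
         (fun mu sigma => (#|Omega rho|%:R)^-1 * L mu sigma).
Proof.
move=> n1 a01 sz slam _ rho12 _ rho_last p01 p_gt0 famP Pi0.
exists (ratio_lim lam rho p Psi); split.
  move=> mu sigma hm _.
  apply: (cvg_ratio n1 a01 sz slam rho_last p01 p_gt0 famP Pi0 hm).
have O0 : #|Omega rho|%:R != 0 :> R.
  rewrite pnatr_eq0 -lt0n; apply/card_gt0P; exists 1%g; exact: Omega1.
split=> [mu sigma hm _||mu' sigma' hm' hs'].
- rewrite mulr_ge0 ?invr_ge0 ?ler0n //.
  exact: (ratio_lim_ge0 n1 a01 sz slam rho_last p01 p_gt0 famP Pi0).
- rewrite exchange_big /=.
  under eq_bigr do rewrite -mulr_sumr
    (sum_ratio_lim n1 a01 sz slam rho_last p01 p_gt0 famP Pi0) mulr1.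
  by rewrite sumr_const -(mulr_natl _^-1) mulfV.
- rewrite -[in LHS](ratio_lim_stationary n1 a01 sz slam rho12 rho_last p01 p_gt0
    famP Pi0 hm' hs') exchange_big /= mulr_sumr.
  apply: eq_bigr => sigma _; rewrite mulr_sumr.
  by apply: eq_bigr => mu _; rewrite mulrA.
Qed.
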